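(* Let $X$ be a real Banach space, $k\in\mathbb{Z}^+$ and $r>1$. Then the following statements are equivalent. (1) $X$ is $k$-WUR. (2) $B_X$ is $k$-$w$USCh on $X$. (3) $B_X$ is $k$-$w$USCh on $rS_X$.
   Context: $B_X$ and $S_X$ are the closed unit ball and unit sphere of $X$; $X^*$ is the dual of $X$. For $x_1,\dots,x_{k+1}\in X$ and $f_1,\dots,f_k\in X^*$, $D_k[(x_i)_{i=1}^{k+1};(f_j)_{j=1}^{k}]$ denotes the determinant of the $(k+1)\times(k+1)$ matrix whose first row consists of ones and whose $(j+1,i)$ entry is $f_j(x_i)$. $X$ is $k$-weakly uniformly rotund ($k$-WUR) if for every $\epsilon>0$ and $f_1,\dots,f_k\in S_{X^*}$, $$\delta^k_X(\epsilon,(f_j)_{j=1}^k):=\inf\Big(\{1\}\cup\Big\{1-\tfrac{1}{k+1}\Big\|\sum_{i=1}^{k+1}x_i\Big\| : x_1,\dots,x_{k+1}\in S_X,\ |D_k[(x_i)_{i=1}^{k+1};(f_j)_{j=1}^{k}]|\ge\epsilon\Big\}\Big)>0.$$ For a non-empty $A\subseteq X$, $x\in X$, $\delta>0$: $d(x,A)=\inf\{\|x-y\|:y\in A\}$ and $P_A(x,\delta)=\{y\in A:\|x-y\|\le d(x,A)+\delta\}$. $A$ is proximinal on $B\subseteq X$ if for every $x\in B$ there is $y\in A$ with $\|x-y\|=d(x,A)$. For non-empty $A,B\subseteq X$, $A$ is $k$-weakly uniformly strongly Chebyshev ($k$-$w$USCh) on $B$ if $A$ is proximinal on $B$ and for every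 $\epsilon>0$ and $f_1,\dots,f_k\in S_{X^*}$ there exists $\delta>0$ such that $|D_k[(x_i)_{i=1}^{k+1};(f_j)_{j=1}^{k}]|\le\epsilon$ whenever $x\in B$ and $x_1,\dots,x_{k+1}\in P_A(x,\delta)$. *)

(* Defs.v *)
From mathcomp Require Import all_boot all_order all_algebra.
From mathcomp Require Import all_classical all_reals topology normedtype.

Set Implicit Arguments.
Unset Strict Implicit.
Unset Printing Implicit Defensive.

Import Order.TTheory GRing.Theory Num.Theory.
Import numFieldNormedType.Exports.

Local Open Scope classical_set_scope.
Local Open Scope ring_scope.

(* [closed_ball] is the closure of the open ball; in a normed space it is
   [set x | `|x| <= 1], see [closed_ballE]. *)
Definition unit_ball (R : realType) (X : normedModType R) : set X :=
  closed_ball (0 : X) 1.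

Definition unit_sphere (R : realType) (X : normedModType R) : set X :=
  [set x | `|x| = 1].

(* Junk value 0 when f is unbounded on the unit ball. *)
Definition dual_norm (R : realType) (X : normedModType R) (f : {scalar X}) : R :=
  sup [set `|f x| | x in @unit_ball R X].

Definition dual_unit_sphere (R : realType) (X : normedModType R) :
    set {scalar X} :=
  [set f : {scalar X} | continuous (f : X -> R^o) /\ dual_norm f = 1].

Definition D_k (R : realType) (X : normedModType R) (k : nat)
    (x : 'I_k.+1 -> X) (f : 'I_k -> {scalar X}) : R :=
  \det (col_mx (const_mx 1 : 'rV[R]_k.+1)
               (\matrix_(j < k, i < k.+1) f j (x i)) : 'M[R]_k.+1).

(* The set contains 1 and is bounded below by 0, so [inf] is a true infimum. *)
Definition wur_modulus (R : realType) (X : normedModType R) (k : nat)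
    (eps : R) (f : 'I_k -> {scalar X}) : R :=
  inf ([set 1] `|`
       [set 1 - k.+1%:R^-1 * `|\sum_(i < k.+1) x i| | x in
          [set x : 'I_k.+1 -> X |
             (forall i, unit_sphere (x i)) /\ eps <= `|D_k x f|]]).

Definition k_WUR (R : realType) (X : normedModType R) (k : nat) : Prop :=
  forall (eps : R) (f : 'I_k -> {scalar X}),
    0 < eps -> (forall j, dual_unit_sphere (f j)) -> 0 < wur_modulus eps f.

(* Meaningful for nonempty A only ([inf set0 = 0]). *)
Definition dist (R : realType) (X : normedModType R) (x : X) (A : set X) : R :=
  inf [set `|x - y| | y in A].

Definition near_proj (R : realType) (X : normedModType R) (A : set X) (x : X)
    (delta : R) : set X :=
  [set y | A y /\ `|x - y| <= dist x A + delta].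

Definition proximinal_on (R : realType) (X : normedModType R)
    (A B : set X) : Prop :=
  forall x, B x -> exists2 y, A y & `|x - y| = dist x A.

Definition k_wUSCh_on (R : realType) (X : normedModType R) (k : nat)
    (A B : set X) : Prop :=
  proximinal_on A B /\
  forall (eps : R) (f : 'I_k -> {scalar X}),
    0 < eps -> (forall j, dual_unit_sphere (f j)) ->
    exists2 delta : R, 0 < delta &
      forall (x : X) (y : 'I_k.+1 -> X),
        B x -> (forall i, near_proj A x delta (y i)) -> `|D_k y f| <= eps.

(* Main.v *)
(** (1) => (2): if the points [y i] of the ball almost realise the distance
    [|x| - 1] from [x], then so does their average, whose norm is thus almost 1;
    normalising the [y i] moves them little, and [D_k] is Lipschitz on the ball.
    If [|x| <= 1] the [y i] are close to [x], and [D_k] vanishes on constants.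

    (3) => (1): for unit vectors [x i] with average [s], shrink towards [s]:
    [y i = (1 - t) s + t x i].  This scales [D_k] by [t ^ k], and when
    [k t <= r - 1] the coefficients of [r s - y i] on the [x j] are nonnegative
    with sum [r - 1], so [y i] almost realises the distance from [r s / |s|]. *)
Require Import Defs.
From mathcomp Require Import all_boot all_order all_algebra all_fingroup.
From mathcomp Require Import all_classical all_reals topology normedtype.
From mathcomp Require Import ring lra.
Set Implicit Arguments.
Unset Strict Implicit.
Unset Printing Implicit Defensive.
Import Order.TTheory GRing.Theory Num.Theory.
Import numFieldNormedType.Exports.
Local Open Scope classical_set_scope.
Local Open Scope ring_scope.

(** * Perturbation of products and determinants *)

Lemma norm_prod_sub_le (R : realDomainType) (n : nat) (a b : 'I_n -> R) (d : R) :
  (forall i, `|a i| <= 1) -> (forall i, `|b i| <= 1) ->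
  (forall i, `|a i - b i| <= d) ->
  `|\prod_i a i - \prod_i b i| <= n%:R * d.
Proof.
elim: n a b => [|n IH] a b ha hb hd.
  by rewrite !big_ord0 subrr normr0 mul0r.
rewrite !big_ord_recr /=.
set p := \prod_(i < n) _; set q := \prod_(i < n) _.
have hpq : `|p - q| <= n%:R * d by apply: IH.
have hq : `|q| <= 1.
  rewrite normr_prod; apply: prodr_ile1 => i _.
  by rewrite normr_ge0 hb.
(* Telescoping: the first [n] factors and the last one are changed separately, and whatever stays
   fixed has modulus at most 1. *)
have -> : p * a ord_max - q * b ord_max =
    (p - q) * a ord_max + q * (a ord_max - b ord_max) by ring.
apply: le_trans (ler_normD _ _) _.
rewrite !normrM -natr1 mulrDl mul1r; apply: lerD.
  by apply: le_trans hpq; rewrite ler_piMr.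
by apply: le_trans (hd ord_max); rewrite ler_piMl.
Qed.

(** Each of the [n!] signed products in the Leibniz expansion moves by at most [n * d]. *)
Lemma norm_det_sub_le (R : realDomainType) (n : nat) (A B : 'M[R]_n) (d : R) :
  (forall i j, `|A i j| <= 1) -> (forall i j, `|B i j| <= 1) ->
  (forall i j, `|A i j - B i j| <= d) ->
  `|\det A - \det B| <= (n`! * n)%:R * d.
Proof.
move=> hA hB hd; rewrite /determinant -sumrB.
apply: le_trans (ler_norm_sum _ _ _) _.
apply: le_trans (_ : \sum_(s : 'S_n) n%:R * d <= _).
  apply: ler_sum => s _; rewrite -mulrBr normrM normrX normrN1 expr1n mul1r.
  exact: norm_prod_sub_le.
by rewrite sumr_const card_Sn -[_ *+ n`!]mulr_natl natrM mulrA.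
Qed.

(** * Norm-one functionals and the distance to the unit ball *)

Section NormedSpace.
Context {R : realType} {X : normedModType R}.
Implicit Types (x y c : X) (k : nat).

Lemma unit_ballE x : unit_ball x = (`|x| <= 1) :> Prop.
Proof. by rewrite /unit_ball closed_ballE //= /closed_ball_ /= sub0r normrN. Qed.

Lemma dual_unit_sphere_le (f : {scalar X}) x :
  dual_unit_sphere f -> `|f x| <= `|x|.
Proof.
case=> _; rewrite /dual_norm; set E := image _ _ => supE.
(* [sup] defaults to 0 on a set without supremum, so the value 1 certifies that [f] is bounded on
   the ball. *)
have hE : has_sup E.
  by apply: contrapT => /sup_out; rewrite supE => /eqP; rewrite oner_eq0.
have [->|x0] := eqVneq x 0; first by rewrite linear0 !normr0.
have nx : 0 < `|x| by rewrite normr_gt0.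
have : `|f (`|x|^-1 *: x)| <= 1.
  rewrite -supE; apply: ub_le_sup; first exact: hE.2.
  exists (`|x|^-1 *: x) => //.
  by rewrite unit_ballE normrZ normfV normr_id mulVf // gt_eqF.
by rewrite linearZ /= normrM normfV normr_id mulrC ler_pdivrMr // mul1r.
Qed.

Lemma has_inf_dist x : has_inf [set `|x - y| | y in @unit_ball R X].
Proof.
split; first by exists `|x - 0|, 0 => //; rewrite unit_ballE normr0.
by exists 0 => _ [y _ <-].
Qed.

Lemma dist_unit_ball_le x y : unit_ball y -> dist x (@unit_ball R X) <= `|x - y|.
Proof. by move=> hy; apply: ge_inf; [exact: (has_inf_dist x).2|exists y]. Qed.

Lemma dist_unit_ball_in x : `|x| <= 1 -> dist x (@unit_ball R X) = 0.
Proof.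
move=> hx; apply/eqP; rewrite eq_le; apply/andP; split.
  by have := @dist_unit_ball_le x x; rewrite subrr normr0 unit_ballE; apply.
by apply: lb_le_inf; [exact: (has_inf_dist x).1|move=> _ [y _ <-]].
Qed.

(** Serves on both sides of the sphere: outside the ball it measures the distance to the nearest
    point, inside it the cost of normalising. *)
Lemma norm_sub_normalize x : x != 0 -> `|x - `|x|^-1 *: x| = `|1 - `|x| |.
Proof.
move=> x0; rewrite -{1}[x]scale1r -scalerBl normrZ.
by rewrite -{2}[`|x|]normr_id -normrM mulrBl mul1r mulVf ?normr_eq0 // distrC.
Qed.

Lemma dist_unit_ball_out x : 1 <= `|x| -> dist x (@unit_ball R X) = `|x| - 1.
Proof.
move=> hx; have x0 : x != 0 by rewrite -normr_gt0; lra.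
apply/eqP; rewrite eq_le; apply/andP; split.
  apply: le_trans (@dist_unit_ball_le x (`|x|^-1 *: x) _) _.
    by rewrite unit_ballE normrZ normfV normr_id mulVf ?normr_eq0.
  by rewrite norm_sub_normalize // distrC ger0_norm // subr_ge0.
apply: lb_le_inf; first exact: (has_inf_dist x).1.
move=> _ [y + <-]; rewrite unit_ballE => hy.
have := lerB_dist x y; lra.
Qed.

Lemma unit_ball_proximinal (B : set X) : proximinal_on (@unit_ball R X) B.
Proof.
move=> x _; have [hx|/ltW hx] := leP `|x| 1.
  by exists x; rewrite ?unit_ballE // subrr normr0 dist_unit_ball_in.
have x0 : x != 0 by rewrite -normr_gt0; lra.
exists (`|x|^-1 *: x).
  by rewrite unit_ballE normrZ normfV normr_id mulVf ?normr_eq0.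
by rewrite dist_unit_ball_out // norm_sub_normalize // distrC ger0_norm // subr_ge0.
Qed.

(** * Behaviour of [D_k] under affine maps and small perturbations *)

(** The map acts on the matrix by left multiplication with a lower triangular block matrix of
    diagonal [1, t, ..., t]: multiples of the row of ones produce the translation. *)
Lemma D_k_affine k (x : 'I_k.+1 -> X) (f : 'I_k -> {scalar X}) c (t : R) :
  D_k (fun i => c + t *: x i) f = t ^+ k * D_k x f.
Proof.
rewrite /D_k.
set M := (X in _ = _ * \det X).
have -> : t ^+ k = \det (block_mx 1%:M 0 (\col_j f j c) t%:M : 'M[R]_(1 + k)).
  by rewrite det_lblock det1 det_scalar mul1r.
rewrite -det_mulmx /M mul_block_col mul1mx mul0mx addr0.
suff -> : \matrix_(j < k, i < k.+1) f j (c + t *: x i) =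
    \col_j f j c *m const_mx 1 + t%:M *m \matrix_(j, i) f j (x i) by [].
apply/matrixP => i j; rewrite mul_scalar_mx !mxE big_ord1 !mxE mulr1.
by rewrite linearD linearZ.
Qed.

(** A constant family is an affine image with [t = 0], and [0 ^+ k] vanishes since [k] is positive;
    for [k = 0] the determinant would be 1. *)
Lemma D_k_const k c (f : 'I_k -> {scalar X}) :
  (0 < k)%N -> D_k (fun _ => c) f = 0.
Proof.
move=> k0; have := @D_k_affine k (fun _ => 0) f c 0.
rewrite expr0n eqn0Ngt k0 mul0r => <-.
by congr D_k; apply/funext => i; rewrite scaler0 addr0.
Qed.

Definition D_k_lip (k : nat) : R := (k.+1`! * k.+1)%:R.

Lemma D_k_lipschitz k (x y : 'I_k.+1 -> X) (f : 'I_k -> {scalar X}) (d : R) :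
  (forall j, dual_unit_sphere (f j)) ->
  (forall i, `|x i| <= 1) -> (forall i, `|y i| <= 1) ->
  (forall i, `|x i - y i| <= d) ->
  `|D_k x f - D_k y f| <= D_k_lip k * d.
Proof.
move=> hf hx hy hd; have d0 : 0 <= d := le_trans (normr_ge0 _) (hd ord0).
have hle j z := dual_unit_sphere_le z (hf j).
apply: norm_det_sub_le => i j; rewrite !mxE.
- by case: splitP => i' _; rewrite !mxE ?normr1 //; apply: le_trans (hle _ _) _.
- by case: splitP => i' _; rewrite !mxE ?normr1 //; apply: le_trans (hle _ _) _.
case: splitP => i' _; rewrite !mxE ?subrr ?normr0 //.
by rewrite -linearB; apply: le_trans (hle _ _) _.
Qed.

Lemma norm_average_le k (x : 'I_k.+1 -> X) (a : R) :
  (forall i, `|x i| <= a) -> `|k.+1%:R^-1 *: \sum_i x i| <= a.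
Proof.
move=> hx; rewrite normrZ ger0_norm ?invr_ge0 // mulrC ler_pdivrMr ?ltr0n //.
apply: le_trans (ler_norm_sum _ _ _) _.
apply: le_trans (_ : \sum_(i < k.+1) a <= _); first exact: ler_sum.
by rewrite sumr_const card_ord mulr_natr.
Qed.

Lemma wur_modulus_le k (eps : R) (f : 'I_k -> {scalar X}) (x : 'I_k.+1 -> X) :
  (forall i, `|x i| = 1) -> eps <= `|D_k x f| ->
  wur_modulus eps f <= 1 - `|k.+1%:R^-1 *: \sum_i x i|.
Proof.
move=> hx hD; apply: ge_inf; last first.
  by right; exists x => //; rewrite normrZ [`|_^-1|]ger0_norm ?invr_ge0.
(* The infimum is genuine: an average of unit vectors has norm at most 1, so 0 is a lower bound. *)
exists 0 => _ [->//|[z [hz _] <-]].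
rewrite subr_ge0 -[k.+1%:R^-1]ger0_norm ?invr_ge0 // -normrZ.
by apply: norm_average_le => i; rewrite hz.
Qed.

(** * From rotundity to the strong Chebyshev property *)

Lemma k_WUR_wUSCh k : (0 < k)%N -> k_WUR X k ->
  k_wUSCh_on k (@unit_ball R X) [set: X].
Proof.
move=> k0 wur; split; first exact: unit_ball_proximinal.
move=> eps f eps0 hf.
set m := wur_modulus (eps / 2) f.
have m0 : 0 < m by apply: wur => //; lra.
set n : R := k.+1%:R; have n1 : 1 <= n by rewrite ler1n.
set L := D_k_lip k.
have L0 : 0 < L by rewrite ltr0n muln_gt0 fact_gt0.
(* The three bounds ensure, in order, that the average of the normalised points has norm above
   [1 - m], that normalising changes [D_k] by at most [eps / 2], and that no [y i] vanishes. *)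
pose d := Num.min (m / (2 * (n + 1))) (Num.min (eps / (2 * L * n)) (1 / (2 * n))).
have d0 : 0 < d.
  have Ln0 : 0 < 2 * L * n by rewrite !mulr_gt0 //; lra.
  by rewrite !lt_min !divr_gt0 //; lra.
have dm : d * (n + 1) < m.
  have : d <= m / (2 * (n + 1)) by rewrite ge_min lexx.
  rewrite ler_pdivlMr; last lra.
  lra.
have dL : L * (n * d) <= eps / 2.
  have : d <= eps / (2 * L * n) by rewrite !ge_min lexx orbT.
  rewrite ler_pdivlMr; last by rewrite !mulr_gt0 //; lra.
  lra.
have dn : n * d <= 2^-1.
  have : d <= 1 / (2 * n) by rewrite !ge_min lexx !orbT.
  rewrite ler_pdivlMr; last lra.
  lra.
exists d => // x y _ hy.
have yB i : `|y i| <= 1 by have [] := hy i; rewrite unit_ballE.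
have hd i : `|x - y i| <= dist x (@unit_ball R X) + d by have [] := hy i.
have dLe : d <= n * d by rewrite ler_peMl // ltW.
have [hx|/ltW hx] := leP `|x| 1.
  have := @D_k_lipschitz k y (fun=> x) f d hf yB (fun=> hx).
  rewrite D_k_const // subr0 => H.
  apply: le_trans (H _) _.
    by move=> i; rewrite distrC -[d]add0r -(dist_unit_ball_in hx).
  have : L * d <= L * (n * d) by rewrite ler_pM2l.
  rewrite -/L; lra.
rewrite dist_unit_ball_out // in hd.
pose s := n^-1 *: \sum_i y i.
have s_ge : 1 - d <= `|s|.
  have H : `|x - s| <= `|x| - 1 + d.
    have -> : x - s = n^-1 *: \sum_(i < k.+1) (x - y i).
      rewrite sumrB sumr_const card_ord scalerBr -/s -scaler_nat scalerA.
      by rewrite mulVf ?scale1r // pnatr_eq0.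
    exact: norm_average_le.
  have := lerB_dist x s; lra.
(* The other [n - 1] summands of [n *: s] have norm at most 1, so an average of norm at least
   [1 - d] leaves at least [1 - n * d] to each [y i]. *)
have y_ge i : 1 - n * d <= `|y i|.
  have : n * `|s| <= `|y i| + (n - 1).
    rewrite /s normrZ ger0_norm ?invr_ge0 ?ler0n // mulrA mulfV ?pnatr_eq0 // mul1r.
    rewrite (bigD1 i) //=; apply: le_trans (ler_normD _ _) _.
    rewrite lerD2l; apply: le_trans (ler_norm_sum _ _ _) _.
    apply: le_trans (_ : \sum_(j < k.+1 | j != i) 1 <= _); first exact: ler_sum.
    by rewrite sumr_const cardC1 card_ord /n -natr1 addrK.
  have : n * (1 - d) <= n * `|s| by rewrite ler_pM2l //; lra.
  lra.
have y0 i : y i != 0 by rewrite -normr_gt0; have := y_ge i; lra.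
pose z i := `|y i|^-1 *: y i.
have z1 i : `|z i| = 1 by rewrite normrZ normfV normr_id mulVf ?normr_eq0.
have yz i : `|y i - z i| <= n * d.
  rewrite norm_sub_normalize // ger0_norm ?subr_ge0 //.
  by have := y_ge i; lra.
(* Otherwise the modulus bounds the norm of the average of the [z i] by [1 - m]; but this average is
   within [n * d] of [s], so its norm is at least [1 - (n + 1) * d]. *)
have Dz : `|D_k z f| < eps / 2.
  rewrite ltNge; apply/negP => /(wur_modulus_le z1); rewrite -/m -/n => Hm.
  have : `|s - n^-1 *: \sum_i z i| <= n * d.
    by rewrite -scalerBr -sumrB; exact: norm_average_le.
  have := lerB_dist s (n^-1 *: \sum_i z i); lra.
have z_le i : `|z i| <= 1 by rewrite z1.
have := D_k_lipschitz hf yB z_le yz.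
have := lerB_dist (D_k y f) (D_k z f).
rewrite -/L; lra.
Qed.

(** * From the strong Chebyshev property on a sphere back to rotundity *)

Lemma wUSCh_k_WUR k (r : R) : (0 < k)%N -> 1 < r ->
  k_wUSCh_on k (@unit_ball R X) [set r *: x | x in @unit_sphere R X] ->
  k_WUR X k.
Proof.
move=> k0 r1 [_ usc] eps f eps0 hf.
set n : R := k.+1%:R; have n1 : 1 <= n by rewrite ler1n.
have K1 : 1 <= k%:R :> R by rewrite ler1n.
have nK : n = k%:R + 1 by rewrite natr1.
pose t := Num.min 1 ((r - 1) / k%:R).
have t0 : 0 < t by rewrite lt_min ltr01 divr_gt0 //; lra.
have t1 : t <= 1 by rewrite ge_min lexx.
have tk : t * k%:R <= r - 1.
  by rewrite -ler_pdivlMr ?ge_min ?lexx ?orbT //; lra.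
have tk0 : 0 < t ^+ k by rewrite exprn_gt0.
(* [t ^+ k] is the factor that [D_k] acquires under shrinking; halving [eps] makes the final
   contradiction with [eps <= |D_k x f|] strict. *)
have [|d d0 hd] := usc (t ^+ k * (eps / 2)) f _ hf.
  by rewrite mulr_gt0 // divr_gt0.
(* [m] will be a lower bound for the modulus: [2^-1] keeps [s] away from 0, and [d / r] keeps
   [r *: s] within [d] of the sphere of radius [r]. *)
pose m := Num.min (d / r) 2^-1.
have m0 : 0 < m by rewrite lt_min divr_gt0 //=; lra.
have m1 : m <= 2^-1 by rewrite ge_min lexx orbT.
have mr : m * r <= d by rewrite -ler_pdivlMr ?ge_min ?lexx //; lra.
apply: lt_le_trans m0 _; apply: lb_le_inf; first by exists 1; left.
move=> _ [->|[x [x1 Dx] <-]]; first lra.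
pose s := n^-1 *: \sum_i x i.
have -> : k.+1%:R^-1 * `|\sum_(i < k.+1) x i| = `|s|.
  by rewrite normrZ ger0_norm // invr_ge0 ler0n.
rewrite leNgt; apply/negP => s_lt.
have x_le i : `|x i| <= 1 by rewrite x1.
have s1 : `|s| <= 1 by exact: norm_average_le.
have s0 : s != 0 by rewrite -normr_gt0; lra.
have ns : s = n^-1 *: \sum_i x i by [].
pose y i := (1 - t) *: s + t *: x i.
have yB i : `|y i| <= 1.
  apply: le_trans (ler_normD _ _) _.
  rewrite [`|(1 - t) *: s|]normrZ [`|t *: x i|]normrZ x1 mulr1.
  rewrite !ger0_norm ?subr_ge0 ?(ltW t0) //.
  have : (1 - t) * `|s| <= 1 - t by rewrite ler_piMr // subr_ge0.
  lra.
have yr i : `|r *: s - y i| <= r - 1.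
  (* Since [r *: s - y i = (r - 1 + t) *: s - t *: x i], each [x j] gets coefficient [a], except
     [x i], which gets [a - t]; [t * k <= r - 1] is exactly [t <= a]. *)
  pose a := (r - 1 + t) / n.
  have a_ge : t <= a by rewrite ler_pdivlMr; lra.
  have an : a * n = r - 1 + t by rewrite mulfVK // pnatr_eq0.
  have -> : r *: s - y i = (a - t) *: x i + a *: \sum_(j < k.+1 | j != i) x j.
    rewrite /y opprD addrA -scalerBl [(a - t) *: _]scalerBl.
    have sumD : \sum_j x j = x i + \sum_(j < k.+1 | j != i) x j by rewrite (bigD1 i).
    rewrite [RHS]addrAC -scalerDr -sumD ns scalerA.
    by congr (_ *: _ - _); rewrite /a; congr (_ / _); ring.
  apply: le_trans (ler_normD _ _) _.
  have a0 : 0 <= a by exact: le_trans (ltW t0) a_ge.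
  rewrite [`|(a - t) *: _|]normrZ [`|a *: _|]normrZ x1 mulr1.
  rewrite [`|a - t|]ger0_norm ?subr_ge0 // (ger0_norm a0).
  have : `|\sum_(j < k.+1 | j != i) x j| <= n - 1.
    apply: le_trans (ler_norm_sum _ _ _) _.
    apply: le_trans (_ : \sum_(j < k.+1 | j != i) 1 <= _); first exact: ler_sum.
    by rewrite sumr_const cardC1 card_ord /n -natr1 addrK.
  move=> /(ler_wpM2l (_ : 0 <= a)) H.
  have := H a0; lra.
pose z := r *: (`|s|^-1 *: s).
have u1 : `| `|s|^-1 *: s| = 1 by rewrite normrZ normfV normr_id mulVf ?normr_eq0.
have z_norm : `|z| = r by rewrite normrZ u1 mulr1 ger0_norm //; lra.
have : `|D_k y f| <= t ^+ k * (eps / 2).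
  apply: (hd z); first by exists (`|s|^-1 *: s).
  move=> i; split; first by rewrite unit_ballE.
  rewrite dist_unit_ball_out z_norm; last exact: ltW.
  (* The first term has norm at most [r - 1], the distance from [z] to the ball; the second has norm
     [r * (1 - |s|)], which is at most [d]. *)
  have -> : z - y i = (r *: s - y i) - r *: (s - `|s|^-1 *: s).
    by rewrite scalerBr opprB [RHS]addrC addrA subrK.
  apply: le_trans (ler_normB _ _) _; apply: lerD => //.
  rewrite normrZ norm_sub_normalize // !ger0_norm ?subr_ge0 //; last lra.
  have : r * (1 - `|s|) <= r * m by rewrite ler_pM2l; lra.
  lra.
rewrite D_k_affine normrM gtr0_norm // ler_pM2l //; lra.
Qed.

End NormedSpace.

Theorem theorem3p15 (R : realType) (X : completeNormedModType R) (k : nat)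
    (r : R) (hk : (0 < k)%N) (hr : 1 < r) :
  [<-> @k_WUR R X k;
       @k_wUSCh_on R X k (@unit_ball R X) [set: X];
       @k_wUSCh_on R X k (@unit_ball R X)
         [set r *: x | x in @unit_sphere R X] ].
Proof.
tfae.
- exact: k_WUR_wUSCh.
- move=> [_ usc]; split; first exact: unit_ball_proximinal.
  move=> eps f eps0 hf; have [d d0 hd] := usc eps f eps0 hf.
  by exists d => // x y _; exact: hd.
- exact: wUSCh_k_WUR.
Qed.
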